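(* Let $G$ be a countable group and let $A$ be a finite-dimensional vector space over a field $K$. Let $\Sigma \subset A^G$ be a linear subshift. Then the following conditions are equivalent: (a) $\Sigma$ is a subshift of finite type (SFT); (b) every decreasing sequence of linear subshifts of $A^G$ $$\Sigma_0 \supset \Sigma_1 \supset \cdots \supset \Sigma_n \supset \Sigma_{n+1} \supset \cdots$$ such that $\Sigma = \bigcap_{n \in \mathbb{N}} \Sigma_n$ eventually stabilizes, that is, there exists $n_0 \in \mathbb{N}$ such that $\Sigma_{n_0} = \Sigma_n$ for all $n \geq n_0$.
   Context: $A^G$ is the $K$-vector space of all maps $x \colon G \to A$, equipped with the prodiscrete topology (product topology with each factor $A$ discrete) and with the shift action of $G$ given by $(gx)(h) = x(g^{-1}h)$. A linear subshift of $A^G$ is a closed $G$-invariant vector subspace of $A^G$. A subset $\Sigma \subset A^G$ is a subshift of finite type (SFT) if there exist a finite subset $D \subset G$ and a subset $P \subset A^D$ such that $\Sigma = \{x \in A^G : (g^{-1}x)|_D \in P \text{ for all } g \in G\}$. $\mathbb{N}$ denotes the non-negative integers. *)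

(* Defs.v *)
From HB Require Import structures.
From mathcomp Require Import all_boot all_order all_algebra finmap.
From mathcomp Require Import boolp classical_sets functions cardinality.
From mathcomp Require Import topology function_spaces.

Set Implicit Arguments.
Unset Strict Implicit.
Unset Printing Implicit Defensive.

Local Open Scope classical_set_scope.

(* The alphabet is wrapped in [discrete_topology], so that [{ptws _ -> _}] is
   the prodiscrete topology; both wrappers are convertible to the identity. *)
Definition prodiscrete_closed (G : Type) (A : choiceType) (S : set (G -> A)) :=
  closed (S : set {ptws G -> discrete_topology A}).

Section Shift.
Variables (G : groupType) (A : Type).

Definition shift_action (g : G) (x : G -> A) : G -> A := fun h => x (g^-1 * h)%g.

Definition shift_invariant (S : set (G -> A)) :=
  forall (g : G) (x : G -> A), S x -> S (shift_action g x).

Definition restriction (D : {fset G}) (x : G -> A) : D -> A :=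
  fun d => x (val d).
Arguments restriction : clear implicits.

Definition subshift_of_finite_type (S : set (G -> A)) :=
  exists (D : {fset G}) (P : set (D -> A)),
    S = [set x | forall g : G, P (restriction D (shift_action g^-1%g x))].

End Shift.

Definition linear_subshift (G : groupType) (K : fieldType) (A : vectType K)
    (S : set (G -> A)) :=
  [/\ prodiscrete_closed S, shift_invariant S & submod_closed [in S]].

(* Main.v *)
(** If [Sigma] is closed and shift-invariant, it is the intersection of its
    local hulls over an exhaustion of [G] by finite sets; these hulls are linear
    subshifts of finite type, so if they stabilize then [Sigma] is one of them.
    Conversely, let [Sigma] be defined by patterns on a finite window [D] and
    be the intersection of a decreasing sequence [X_]. Finite-dimensionality
    makes the restrictions of the [X_ n] to every finite set stabilize, and a
    Mittag-Leffler argument identifies the stable restriction to [D] with that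
    of [Sigma]. Hence some [X_ m] has only patterns of [Sigma] on [D], and by
    invariance on all translates of [D], so [X_ m = Sigma]. *)

Require Import Defs.
From mathcomp Require Import all_boot all_algebra finmap.
From mathcomp Require Import boolp classical_sets functions cardinality.
From mathcomp Require Import topology function_spaces.

Set Implicit Arguments.
Unset Strict Implicit.
Unset Printing Implicit Defensive.

Import GRing.Theory.

Local Open Scope classical_set_scope.

(** * Cylinders in the prodiscrete topology *)

Section ProdiscreteClosed.
Variables (G A : choiceType).
Implicit Types (x y : G -> A) (S : set (G -> A)) (s : seq G).

Local Notation ptws := {ptws G -> discrete_topology A}.

Lemma nbhs_cylinder x s : nbhs (x : ptws) [set y : G -> A | {in s, y =1 x}].
Proof.
have xF : Filter (nbhs (x : ptws)) by exact: nbhs_filter.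
elim: s => [|g s IHs]; first by apply: filterS filterT => y _ g.
have xg : nbhs (x : ptws) [set y : G -> A | y g = x g].
  exact: (@proj_continuous G (fun=> discrete_topology A) g x [set x g]).
apply: filterS (filterI xg IHs) => y [/= yxg yxs] h.
by rewrite inE => /predU1P[->|/yxs].
Qed.

Lemma cylinder_of_nbhs x (B : set (G -> A)) :
  nbhs (x : ptws) B -> exists s, [set y : G -> A | {in s, y =1 x}] `<=` B.
Proof.
pose F : set_system (G -> A) :=
  [set C | exists s, [set y : G -> A | {in s, y =1 x}] `<=` C].
have FF : Filter F.
  split; first by exists [::].
    move=> C C' [s sC] [s' sC']; exists (s ++ s') => y /= yx; split.
      by apply: sC => g gs; apply: yx; rewrite mem_cat gs.
    by apply: sC' => g gs; apply: yx; rewrite mem_cat gs orbT.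
  by move=> C C' CC' [s sC]; exists s; apply: subset_trans sC CC'.
(* The product topology is the supremum of the topologies pulled back along evaluations, so
   convergence of [F] to [x] is checked one coordinate at a time. *)
move: B; change (F --> (x : ptws)); apply/cvg_sup => g B.
rewrite nbhsE => -[C [[O oO OC] Cx] CB]; exists [:: g] => y /= yx.
by apply: CB; move: Cx; rewrite -OC /= yx // mem_head.
Qed.

Lemma prodiscrete_closedP S : prodiscrete_closed S <->
  forall x, (forall s, exists2 y, S y & {in s, y =1 x}) -> S x.
Proof.
split=> [Scl x xS|Scl x xS].
  apply: Scl => B /cylinder_of_nbhs[s sB]; have [y Sy yx] := xS s.
  by exists y; split => //; apply: sB.
by apply: Scl => s; have [y [Sy yx]] := xS _ (nbhs_cylinder x s); exists y.
Qed.

End ProdiscreteClosed.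

(** * Descending chains of subspaces; exhaustions of countable sets *)

Lemma submod_closedP (K : fieldType) (V : lmodType K) (S : set V) :
  submod_closed [in S] <->
  S 0%R /\ forall a u v, S u -> S v -> S (a *: u + v)%R.
Proof.
split=> [[S0 SL]|[S0 SL]].
  split=> [|a u v Su Sv]; first by rewrite -in_setE.
  by rewrite -in_setE; apply: SL; rewrite unfold_in /= in_setE.
split=> [|a u v]; rewrite !unfold_in /= !in_setE //; exact: SL.
Qed.

(** A [U] of maximal dimension inside [V] absorbs each [v] in [V], since [U + <[v]>] still lies in
    [V]. This makes dimension available for set-level subspaces. *)
Lemma vspace_of_submod (K : fieldType) (A : vectType K) (V : set A) :
  submod_closed [in V] -> exists U : {vspace A}, V = [set` U].
Proof.
move=> /submod_closedP[V0 VL].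
pose P d := `[< exists2 U : {vspace A}, [set` U] `<=` V & \dim U = d >].
have exP : exists d, P d.
  exists 0%N; apply/asboolP; exists 0%VS; last exact: dimv0.
  by move=> v /=; rewrite memv0 => /eqP->.
have Pmax d : P d -> d <= \dim {:A}.
  by move=> /asboolP[U _ <-]; rewrite dimvS // subvf.
case: (ex_maxnP exP Pmax) => d /asboolP[U UV <-] Umax.
exists U; apply/seteqP; split=> // v Vv /=.
suff /eqP -> : U == (U + <[v]>)%VS.
  by apply: (subvP (addvSr U _)); rewrite memv_line.
rewrite eqEdim addvSl Umax //; apply/asboolP.
exists (U + <[v]>)%VS => // w /= /memv_addP[u uU [_ /vlineP[k ->] ->]].
by rewrite addrC; apply: VL => //; apply: UV.
Qed.

Lemma homo_subset (T : Type) (X_ : nat -> set T) :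
  (forall n, X_ n.+1 `<=` X_ n) -> forall m n, m <= n -> X_ n `<=` X_ m.
Proof.
move=> Xdec m n /subnK <-; elim: (n - m)%N => // k IH.
by rewrite addSn; apply: subset_trans (Xdec _) IH.
Qed.

Lemma submod_dcc (K : fieldType) (A : vectType K) (V_ : nat -> set A) :
  (forall n, submod_closed [in V_ n]) -> (forall n, V_ n.+1 `<=` V_ n) ->
  exists m, forall n, V_ m `<=` V_ n.
Proof.
move=> /(fun H n => vspace_of_submod (H n)) /choice[U_ VU] Vdec.
have exd : exists d, `[< exists m, \dim (U_ m) = d >].
  by exists (\dim (U_ 0%N)); apply/asboolP; exists 0%N.
case: (ex_minnP exd) => d /asboolP[m <-] dmin.
exists m => n; have [/(homo_subset Vdec)//|/ltnW le_mn] := leqP n m.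
suff /eqP eqU : U_ n == U_ m by rewrite (VU m) (VU n) eqU.
rewrite eqEdim dmin ?andbT; last by apply/asboolP; exists n.
by apply/subvP => v; have := @homo_subset _ _ Vdec _ _ le_mn v; rewrite !VU.
Qed.

Lemma countable_exhaustion (G : choiceType) : countable [set: G] ->
  exists2 E_ : nat -> {fset G},
    forall j k, (j <= k)%N -> (E_ j `<=` E_ k)%fset
    & forall s : seq G, exists k, {subset s <= E_ k}.
Proof.
move=> /countable_injP[f finj].
have {}finj : injective f by move=> g h; apply: finj; rewrite in_setT.
(* Sublevel sets of the injection [f]: each step adds at most one point. *)
have /choice[E_ EP] (k : nat) : exists E : {fset G},
    forall g, (g \in E) = (f g < k).
  elim: k => [|k [E EP]]; first by exists fset0.
  have [[g0 fg0]|nf] := pselect (exists g, f g = k).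
    exists (g0 |` E)%fset => g.
    by rewrite in_fset1U EP ltnS [RHS]leq_eqVlt -fg0 (inj_eq finj).
  exists E => g; rewrite EP ltnS [RHS]leq_eqVlt; case: eqP => // fg.
  by case: nf; exists g.
exists E_ => [j k jk|s].
  by apply/fsubsetP => g; rewrite !EP => /leq_trans; apply.
elim: s => [|g s [k sk]]; first by exists 0%N.
exists (maxn (f g).+1 k) => h; rewrite inE EP => /predU1P[->|/sk].
  exact: leq_maxl.
by rewrite EP => /leq_trans; apply; rewrite leq_maxr.
Qed.

(** * Linear compactness of decreasing sequences *)

Section LinearCompactness.
Variables (G : choiceType) (K : fieldType) (A : vectType K).
Variable X_ : nat -> set (G -> A).
Hypothesis Xlin : forall n, submod_closed [in X_ n].
Hypothesis Xdec : forall n, X_ n.+1 `<=` X_ n.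

Lemma restriction_dcc (s : seq G) : exists m, forall x, X_ m x ->
  forall n, exists2 y, X_ n y & {in s, y =1 x}.
Proof.
have X0 n : X_ n 0%R by have /submod_closedP[] := Xlin n.
have XL n a u v : X_ n u -> X_ n v -> X_ n (a *: u + v)%R.
  by have /submod_closedP[_] := Xlin n; apply.
elim: s => [|g s [m IHm]]; first by exists 0%N => x _ n; exists 0%R.
(* [V_ n] is the kernel of the restriction map from [g :: s] to [s] on patterns of [X_ n]. Once
   these kernels and the images on [s] are stable, so are the images on [g :: s]. *)
pose V_ n := [set v : A | exists x, [/\ X_ n x, {in s, forall h, x h = 0%R}
  & x g = v]].
have Vlin n : submod_closed [in V_ n].
  apply/submod_closedP; split=> [|a _ _ [x [Xx xs <-]] [y [Xy ys <-]]].
    by exists 0%R; split.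
  exists (a *: x + y)%R; split=> // [|h hs]; first exact: XL.
  by change (a *: x h + y h = 0)%R; rewrite xs // ys // addr0 scaler0.
have [|p Vp] := submod_dcc Vlin.
  by move=> n v [x [Xx xs xg]]; exists x; split=> //; exact: Xdec.
exists (maxn m p) => x Xx n.
have Xmx : X_ m x by apply: homo_subset Xx; rewrite ?leq_maxl.
(* Index [maxn n p] puts [y] both in [X_ n] and in [X_ p]. Then [x - y] lies in [X_ p] and vanishes
   on [s], so its value at [g] is attained by some [z] in [X_ n] vanishing on [s], and [z + y] is
   the required point. *)
have [y Xy yx] := IHm x Xmx (maxn n p).
have Xpx : X_ p x by apply: homo_subset Xx; rewrite ?leq_maxr.
have Xpy : X_ p y by apply: homo_subset Xy; rewrite ?leq_maxr.
have Xny : X_ n y by apply: homo_subset Xy; rewrite ?leq_maxl.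
have [|z [Xz zs zg]] := Vp n (x g - y g)%R.
  exists (-1 *: y + x)%R; split=> [|h hs|]; first exact: XL.
    by change (-1 *: y h + x h = 0)%R; rewrite yx // scaleN1r addNr.
  by change (-1 *: y g + x g = x g - y g)%R; rewrite scaleN1r addrC.
exists (1 *: z + y)%R => [|h]; first exact: XL.
change (h \in g :: s -> 1 *: z h + y h = x h)%R; rewrite scale1r.
by rewrite inE => /predU1P[->|hs]; rewrite ?zg ?subrK // zs // yx // add0r.
Qed.

(* Mittag-Leffler: the stable images of the [X_ n] in the coordinates [E k]
   map onto one another, so a compatible sequence can be chosen by recursion
   and glued to a point of the intersection. *)
Lemma bigcap_restriction (s : seq G) :
  countable [set: G] -> (forall n, prodiscrete_closed (X_ n)) ->
  exists m, forall x, X_ m x ->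
    exists2 y, (\bigcap_n X_ n) y & {in s, y =1 x}.
Proof.
move=> /countable_exhaustion[F_ Fle Fexh] Xcl.
(* Prefixing [s] puts it in [E_ 0], so the recursion started at [x] never changes the values on
   [s]. *)
pose E_ k : seq G := s ++ F_ k.
have E_le j k : j <= k -> {subset E_ j <= E_ k}.
  move=> /Fle /fsubsetP jk g; rewrite !mem_cat => /orP[->//|/jk ->].
  by rewrite orbT.
have /choice[i_ iP] (g : G) : exists i, g \in E_ i.
  have [i iP] := Fexh [:: g]; exists i.
  by rewrite mem_cat iP ?mem_head // orbT.
have /choice[m_ mP] := fun k => restriction_dcc (E_ k).
exists (m_ 0%N) => x Xx.
have /choice[step stepP] (kx : nat * (G -> A)) : exists y,
    X_ (m_ kx.1) kx.2 -> X_ (m_ kx.1.+1) y /\ {in E_ kx.1, y =1 kx.2}.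
  have [Xk|nXk] := pselect (X_ (m_ kx.1) kx.2); last by exists kx.2.
  by have [y Xy yx] := mP kx.1 _ Xk (m_ kx.1.+1); exists y.
pose x_ := fix x_ k := if k is k'.+1 then step (k', x_ k') else x.
have Xx_ k : X_ (m_ k) (x_ k).
  by elim: k => // k IH; have [] := stepP (k, x_ k) IH.
have x_S k : {in E_ k, x_ k.+1 =1 x_ k}.
  by have [] := stepP (k, x_ k) (Xx_ k).
have x_le j k : j <= k -> {in E_ j, x_ k =1 x_ j}.
  move=> /subnK <-; elim: (k - j)%N => // i IH g gj.
  by rewrite addSn x_S ?IH //; apply: E_le gj; rewrite leq_addl.
(* The choice of [i_ g] is immaterial: by [x_le] the value at [g] is constant from any [k] with [g]
   in [E_ k]. *)
pose y g := x_ (i_ g) g.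
have yx k : {in E_ k, y =1 x_ k}.
  move=> g gk; rewrite /y; have [le_ik|lt_ki] := leqP (i_ g) k.
    by rewrite (x_le _ _ le_ik).
  by rewrite (x_le _ _ (ltnW lt_ki)).
exists y => [n _|g gs]; last by rewrite (yx 0%N) // mem_cat gs.
have /prodiscrete_closedP := Xcl n; apply=> t.
have [k tF] := Fexh t.
have tk : {subset t <= E_ k} by move=> g /tF gF; rewrite mem_cat gF orbT.
have [z Xz zx] := mP k _ (Xx_ k) n.
by exists z => // g /tk gk; rewrite zx // (yx k).
Qed.

End LinearCompactness.

(** * Shifts and local hulls *)

Section Shift.
Variables (G : groupType) (A : Type).
Implicit Types (x y : G -> A) (D : {fset G}).

Lemma shift_action1 x : shift_action 1%g x = x.
Proof. by apply/funext => h; rewrite /shift_action invg1 mul1g. Qed.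

Lemma shift_actionM g h x :
  shift_action g (shift_action h x) = shift_action (g * h)%g x.
Proof. by apply/funext => k; rewrite /shift_action invgM mulgA. Qed.

Lemma eq_restriction D x y :
  @restriction _ _ D x = @restriction _ _ D y <-> {in D, x =1 y}.
Proof.
split=> [xy g gD|xy]; first by have := congr1 (@^~ [` gD]%fset) xy.
by apply/funext => d; apply: xy; exact: valP.
Qed.

(** For shift-invariant [S], this is the smallest subshift of finite type with window [D] that
    contains [S]. *)
Definition local_hull (D : {fset G}) (S : set (G -> A)) : set (G -> A) :=
  [set x | forall g, exists2 y, S y & {in D, y =1 shift_action g^-1%g x}].

Lemma local_hull_sft D S : subshift_of_finite_type (local_hull D S).
Proof.
exists D, [set p | exists2 y, S y & @restriction _ _ D y = p].
apply/seteqP; split=> x xS g; have [y Sy] := xS g; exists y => //.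
  exact/eq_restriction.
exact/eq_restriction.
Qed.

Lemma sub_local_hull D S : shift_invariant S -> S `<=` local_hull D S.
Proof.
by move=> Sinv x Sx g; exists (shift_action g^-1%g x) => //; exact: Sinv.
Qed.

Lemma local_hullS D D' S : (D `<=` D')%fset ->
  local_hull D' S `<=` local_hull D S.
Proof.
move=> /fsubsetP DD' x xS g; have [y Sy yx] := xS g.
by exists y => // h /DD'; exact: yx.
Qed.

End Shift.

Lemma local_hull_linear_subshift (G : groupType) (K : fieldType)
    (A : vectType K) (D : {fset G}) (S : set (G -> A)) :
  linear_subshift S -> linear_subshift (local_hull D S).
Proof.
move=> [_ _ /submod_closedP[S0 SL]]; split.
- apply/prodiscrete_closedP => x xS g.
  (* On [D], the shift of [x] by [g^-1] reads [x] exactly on the translate of [D] by [g]. *)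
  have [y yS yx] := xS [seq (g * d)%g | d <- D].
  have [z Sz zy] := yS g; exists z => // d dD.
  by rewrite zy // /shift_action invgK yx // map_f.
- move=> g x xS h; have [y Sy yx] := xS (g^-1 * h)%g.
  by exists y => // d dD; rewrite yx // shift_actionM invgM invgK.
- apply/submod_closedP; split=> [g|a u v uS vS g]; first by exists 0%R.
  have [u' Su' uu'] := uS g; have [v' Sv' vv'] := vS g.
  exists (a *: u' + v')%R => [|d dD]; first exact: SL.
  change (a *: u' d + v' d =
    a *: shift_action g^-1 u d + shift_action g^-1 v d)%R.
  by rewrite uu' // vv'.
Qed.

Theorem theorem1p1 (G : groupType) (K : fieldType) (A : vectType K)
    (Sigma : set (G -> A)) :
  countable [set: G] ->
  linear_subshift Sigma ->
  subshift_of_finite_type Sigma <->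
  (forall Sigma_ : nat -> set (G -> A),
     (forall n, linear_subshift (Sigma_ n)) ->
     (forall n, Sigma_ n.+1 `<=` Sigma_ n) ->
     Sigma = \bigcap_n Sigma_ n ->
     exists n0, forall n, (n0 <= n)%N -> Sigma_ n0 = Sigma_ n).
Proof.
move=> Gcount Slin; split=> [[D [P SigmaE]] X_ Xlin Xdec SX|stab].
  have [||m mP] := bigcap_restriction _ Xdec D Gcount.
  - by move=> n; have [] := Xlin n.
  - by move=> n; have [] := Xlin n.
  suff XmS : X_ m `<=` Sigma.
    exists m => n le_mn; apply/seteqP; split; last exact: homo_subset.
    by move=> x /XmS; rewrite SX; apply.
  move=> x Xx; rewrite SigmaE => g.
  have [|y] := mP (shift_action g^-1%g x).
    by have [_ Xinv _] := Xlin m; exact: Xinv.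
  (* At the identity, the pattern of [y] on [D] is allowed; it is also the pattern of the shifted
     [x]. *)
  rewrite -SX SigmaE => /(_ 1%g) + yx; rewrite invg1 shift_action1.
  by have /eq_restriction -> := yx.
have [E_ E_le Eexh] := countable_exhaustion Gcount.
pose X_ n := local_hull (E_ n) Sigma.
have [Scl Sinv _] := Slin.
have Xdec n : X_ n.+1 `<=` X_ n by apply: local_hullS; exact: E_le.
have SX : Sigma = \bigcap_n X_ n.
  apply/seteqP; split=> [x Sx n _|x xX]; first exact: sub_local_hull.
  have /prodiscrete_closedP := Scl; apply=> s.
  have [k sk] := Eexh s; have [y Sy] := xX k I 1%g.
  by rewrite invg1 shift_action1 => yx; exists y => // g /sk; exact: yx.
have [|m mP] := stab X_ _ Xdec SX.
  by move=> n; exact: local_hull_linear_subshift.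
suff -> : Sigma = X_ m by exact: local_hull_sft.
rewrite SX; apply/seteqP; split=> [x /(_ m I)//|x Xx n _].
have [/mP <-//|/ltnW le_nm] := leqP m n.
exact: (homo_subset Xdec le_nm).
Qed.
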